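(* Let $t$ be a term and $A$ a formula of $\mathcal{L}_1$, and let $\xi$ be an environment whose domain includes the free variables of $t$ and $A$ and such that $\xi(x)$ is strongly convergent for every such variable $x$. Then $[\![t]\!]_\xi\in\mathcal{S}\mathbb{N}$ and $[\![A]\!]_\xi\in\mathcal{S}\mathrm{Bool}$ are strongly convergent.
   Context: $\mathcal{L}_0$: quantifier-free language of primitive recursive arithmetic (variables, $0$, $\mathsf{succ}$, a function symbol for each primitive recursive function, a predicate symbol for each syntactic definition of a primitive recursive predicate, $=$, connectives $\neg,\wedge,\vee,\rightarrow$). $\mathcal{L}_1$ adds, for each $(k+1)$-ary predicate symbol $P$, a $k$-ary function symbol $\varphi_P$ and a $k$-ary predicate symbol $\chi_P$. A state is a finite set $s$ of triples $\langle P,\vec m,n\rangle$ ($\vec m\in\mathbb{N}^k$, $P$ of arity $k+1$) such that $P(\vec m,n)$ holds in the standard model and $\langle P,\vec m,n\rangle,\langle P,\vec m,n'\rangle\in s$ implies $n=n'$; $\mathbb{S}$ is the set of states ordered by inclusion. $\mathcal{S}X=\{\text{functions }\mathbb{S}\to X\}$. $[\![\chi_P]\!](\vec m,s)=\mathsf{true}$ iff some $\langle P,\vec m,n\rangle\in s$; $[\![\varphi_P]\!](\vec m,s)=n$ if $\langle P,\vec m,n\rangle\in s$, else $0$. An environment is $\xi:\mathrm{Var}\to\mathcal{S}\mathbb{N}$; $[\![x]\!]_\xi=\xi(x)$, $[\![0]\!]_\xi=\lambda s.0$, $[\![f(\vec t)]\!]_\xi(s)=f([\![\vec t]\!]_\xi(s))$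 and $[\![Q(\vec t)]\!]_\xi(s)=Q([\![\vec t]\!]_\xi(s))$ for symbols of $\mathcal{L}_0$ with standard meanings $f,Q$, $[\![\varphi_P(\vec t)]\!]_\xi(s)=[\![\varphi_P]\!]([\![\vec t]\!]_\xi(s),s)$, $[\![\chi_P(\vec t)]\!]_\xi(s)=[\![\chi_P]\!]([\![\vec t]\!]_\xi(s),s)$, connectives pointwise boolean. A weakly increasing sequence is $\sigma:\mathbb{N}\to\mathbb{S}$ with $\sigma(i)\subseteq\sigma(j)$ for $i\le j$; $\alpha\in\mathcal{S}X$ is strongly convergent if for every weakly increasing $\sigma$ the sequence $(\alpha(\sigma(i)))_i$ is eventually constant. *)

(* Defs.v *)
From mathcomp Require Import all_boot.
From mathcomp Require Import boolp classical_sets functions cardinality.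

Set Implicit Arguments.
Unset Strict Implicit.
Unset Printing Implicit Defensive.

Local Open Scope classical_set_scope.

(* Definitions of the k-ary primitive recursive functions.  The function defined
   by [PRrec g h] satisfies f (0, v) = g v and
   f (n + 1, v) = h (n, f (n, v), v). *)
Inductive prim_rec : nat -> Type :=
  | PRzero k : prim_rec k
  | PRsucc : prim_rec 1
  | PRproj k (i : 'I_k) : prim_rec k
  | PRcomp k l (h : prim_rec l) (g : 'I_l -> prim_rec k) : prim_rec k
  | PRrec k (g : prim_rec k) (h : prim_rec k.+2) : prim_rec k.+1.

Fixpoint pr_eval k (f : prim_rec k) : k.-tuple nat -> nat :=
  match f in prim_rec k return k.-tuple nat -> nat with
  | PRzero _ => fun=> 0
  | PRsucc => fun v => (thead v).+1
  | PRproj _ i => fun v => tnth v i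
  | PRcomp _ l h g => fun v => pr_eval h [tuple pr_eval (g i) v | i < l]
  | PRrec _ g h => fun v =>
      iteri (thead v) (fun n r => pr_eval h [tuple of n :: r :: behead v])
        (pr_eval g [tuple of behead v])
  end.

Definition fun_sym (k : nat) : Type := prim_rec k.

(* A primitive recursive predicate is defined through a primitive recursive
   function [pr_char], and holds where that function does not vanish. *)
Record pred_sym (k : nat) : Type := PredSym { pr_char : prim_rec k }.

Definition pred_eval k (P : pred_sym k) (v : k.-tuple nat) : bool :=
  pr_eval (pr_char P) v != 0.

Definition var : Type := nat.

(* [TPhi P ts] is phi_P(ts) and [FChi P ts] is chi_P(ts). *)
Inductive term : Type :=
  | TVar (x : var)
  | TZero
  | TSucc (t : term)
  | TFun k (f : fun_sym k) (ts : 'I_k -> term)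
  | TPhi k (P : pred_sym k.+1) (ts : 'I_k -> term).

Inductive formula : Type :=
  | FPred k (Q : pred_sym k) (ts : 'I_k -> term)
  | FEq (t u : term)
  | FChi k (P : pred_sym k.+1) (ts : 'I_k -> term)
  | FNot (A : formula)
  | FAnd (A B : formula)
  | FOr (A B : formula)
  | FImp (A B : formula).

Fixpoint fv_term (t : term) : set var :=
  match t with
  | TVar x => [set x]
  | TZero => set0
  | TSucc u => fv_term u
  | TFun _ _ ts => \bigcup_i fv_term (ts i)
  | TPhi _ _ ts => \bigcup_i fv_term (ts i)
  end.

Fixpoint fv_formula (A : formula) : set var :=
  match A with
  | FPred _ _ ts => \bigcup_i fv_term (ts i)
  | FEq t u => fv_term t `|` fv_term u
  | FChi _ _ ts => \bigcup_i fv_term (ts i)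
  | FNot B => fv_formula B
  | FAnd B C => fv_formula B `|` fv_formula C
  | FOr B C => fv_formula B `|` fv_formula C
  | FImp B C => fv_formula B `|` fv_formula C
  end.

Record triple : Type := Triple {
  triple_arity : nat;
  triple_pred : pred_sym triple_arity.+1;
  triple_args : triple_arity.-tuple nat;
  triple_val : nat
}.

Record state : Type := State {
  state_set : set triple;
  state_finite : finite_set state_set;
  state_sound : forall k (P : pred_sym k.+1) (m : k.-tuple nat) (n : nat),
    state_set (Triple P m n) -> pred_eval P [tuple of rcons m n];
  state_functional :
    forall k (P : pred_sym k.+1) (m : k.-tuple nat) (n n' : nat),
    state_set (Triple P m n) -> state_set (Triple P m n') -> n = n'
}.

Definition SS (X : Type) : Type := state -> X.

Definition chi k (P : pred_sym k.+1) (m : k.-tuple nat) : SS bool :=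
  fun s => `[< exists n, state_set s (Triple P m n) >].

(* [xget 0 B] is an element of [B] if there is one and 0 otherwise; here [B] has
   at most one element by [state_functional]. *)
Definition phi k (P : pred_sym k.+1) (m : k.-tuple nat) : SS nat :=
  fun s => xget 0 [set n | state_set s (Triple P m n)].

Definition environment : Type := var -> SS nat.

Fixpoint eval_term (xi : environment) (t : term) : SS nat :=
  match t with
  | TVar x => xi x
  | TZero => fun=> 0
  | TSucc u => fun s => (eval_term xi u s).+1
  | TFun k f ts => fun s => pr_eval f [tuple eval_term xi (ts i) s | i < k]
  | TPhi k P ts => fun s => phi P [tuple eval_term xi (ts i) s | i < k] s
  end.

Fixpoint eval_formula (xi : environment) (A : formula) : SS bool :=
  match A with
  | FPred k Q ts => fun s => pred_eval Q [tuple eval_term xi (ts i) s | i < k]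
  | FEq t u => fun s => eval_term xi t s == eval_term xi u s
  | FChi k P ts => fun s => chi P [tuple eval_term xi (ts i) s | i < k] s
  | FNot B => fun s => ~~ eval_formula xi B s
  | FAnd B C => fun s => eval_formula xi B s && eval_formula xi C s
  | FOr B C => fun s => eval_formula xi B s || eval_formula xi C s
  | FImp B C => fun s => eval_formula xi B s ==> eval_formula xi C s
  end.

Definition weakly_increasing (sigma : nat -> state) : Prop :=
  forall i j, i <= j -> state_set (sigma i) `<=` state_set (sigma j).

Definition eventually_constant (X : Type) (u : nat -> X) : Prop :=
  exists N, forall i, N <= i -> u i = u N.

Definition strongly_convergent (X : Type) (alpha : SS X) : Prop :=
  forall sigma, weakly_increasing sigma ->
    eventually_constant (fun i => alpha (sigma i)).

(* Main.v *)
Require Import Defs.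
From mathcomp Require Import all_boot.
From mathcomp Require Import boolp classical_sets.

(** Along a weakly increasing sequence of states, the set of answers for a fixed
    query [P, m] is eventually constant: once nonempty it is a singleton that
    never changes.  The arguments of a symbol are eventually constant by
    induction, so past some point the query itself is fixed. *)

Lemma eventually_constant_cst (X : Type) (x : X) :
  eventually_constant (fun=> x).
Proof. by exists 0. Qed.

Lemma eventually_constant_comp (X Y : Type) (f : X -> Y) (u : nat -> X) :
  eventually_constant u -> eventually_constant (fun i => f (u i)).
Proof. by case=> N uN; exists N => i /uN ->. Qed.

(** Once [u] has settled at [u N], the diagonal follows the single sequence [F (u N)], so no
    uniformity in [x] is required. This serves [phi] and [chi], where the state acts both on the
    arguments and on the symbol. *)
Lemma eventually_constant_diag (X Y : Type) (F : X -> nat -> Y) (u : nat -> X) :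
  eventually_constant u -> (forall x, eventually_constant (F x)) ->
  eventually_constant (fun i => F (u i) i).
Proof.
move=> [N uN] Fec; have [M FM] := Fec (u N).
exists (maxn N M) => i; rewrite geq_max => /andP[Ni Mi].
by rewrite !uN ?leq_maxl // !FM ?leq_maxr.
Qed.

Lemma eventually_constant_comp2 (X Y Z : Type) (f : X -> Y -> Z)
    (u : nat -> X) (v : nat -> Y) :
  eventually_constant u -> eventually_constant v ->
  eventually_constant (fun i => f (u i) (v i)).
Proof.
move=> uc vc; apply: (@eventually_constant_diag _ _ (fun x i => f x (v i)) u uc).
by move=> x; apply: eventually_constant_comp.
Qed.

Lemma eventually_constant_tuple (X : Type) (k : nat) (u : 'I_k -> nat -> X) :
  (forall j, eventually_constant (u j)) ->
  eventually_constant (fun i => [tuple u j i | j < k]).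
Proof.
move=> /choice[N uN].
(* Finitely many components: past the largest of their bounds all have settled. *)
exists (\max_j N j) => i le_i; apply: eq_from_tnth => j; rewrite !tnth_mktuple.
rewrite uN ?[in RHS]uN ?leq_bigmax //.
by apply: leq_trans le_i; apply: leq_bigmax.
Qed.

Lemma eventually_constant_answers (sigma : nat -> state) (k : nat)
    (P : pred_sym k.+1) (m : k.-tuple nat) :
  weakly_increasing sigma ->
  eventually_constant
    (fun i => [set n | state_set (sigma i) (Triple P m n)]%classic).
Proof.
move=> incr.
have [[N [n sn]]|noans] :=
  pselect (exists i n, state_set (sigma i) (Triple P m n)).
  (* The answer [n] found at stage [N] persists in [sigma i], where functionality forces any [n'] to
     equal it. *)
  exists N => i Ni; apply/seteqP; split => n' /= sn'; last exact: incr sn'.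
  by rewrite (state_functional sn' (incr _ _ Ni _ sn)).
by exists 0 => i _; apply/seteqP; split => n sn; case: noans; [exists i, n|exists 0, n].
Qed.

(** [phi P m] sees the state only through its set of answers; the default 0 is kept until an answer
    appears, if one ever does. *)
Lemma phi_strongly_convergent (k : nat) (P : pred_sym k.+1) (m : k.-tuple nat) :
  strongly_convergent (phi P m).
Proof.
move=> sigma /eventually_constant_answers - /(_ k P m).
exact: eventually_constant_comp.
Qed.

Lemma chi_strongly_convergent (k : nat) (P : pred_sym k.+1) (m : k.-tuple nat) :
  strongly_convergent (chi P m).
Proof.
move=> sigma /eventually_constant_answers - /(_ k P m).
exact: (@eventually_constant_comp _ _ (fun B => `[< exists n, B n >])).
Qed.

Lemma eval_term_strongly_convergent (xi : environment) (t : term) :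
  (forall x, fv_term t x -> strongly_convergent (xi x)) ->
  strongly_convergent (eval_term xi t).
Proof.
(* [sigma] is fixed before the induction, while the hypothesis on variables stays in the goal so
   that it can be restricted to each subterm. *)
move=> + sigma incr.
elim: t => [x||t IH|k f ts IH|k P ts IH] /= hxi.
- exact: hxi.
- exact: eventually_constant_cst.
- by apply: eventually_constant_comp; apply: IH.
- apply: eventually_constant_comp; apply: eventually_constant_tuple => j.
  by apply: IH => x fvx; apply: hxi; exists j.
- apply: (@eventually_constant_diag _ _ (fun v i => phi P v (sigma i))).
    apply: eventually_constant_tuple => j.
    by apply: IH => x fvx; apply: hxi; exists j.
  by move=> v; apply: phi_strongly_convergent.
Qed.

Lemma eval_formula_strongly_convergent (xi : environment) (A : formula) :
  (forall x, fv_formula A x -> strongly_convergent (xi x)) ->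
  strongly_convergent (eval_formula xi A).
Proof.
move=> + sigma incr.
elim: A => [k Q ts|t u|k P ts|B IHB|B IHB C IHC|B IHB C IHC|B IHB C IHC] /= hxi.
- apply: eventually_constant_comp; apply: eventually_constant_tuple => j.
  by apply: eval_term_strongly_convergent => // x fvx; apply: hxi; exists j.
- by apply: eventually_constant_comp2; apply: eval_term_strongly_convergent => //
    x fvx; apply: hxi; [left|right].
(* The two occurrences of the state are separated: [v] stands for the argument tuple, [i] drives
   only the interpretation of the symbol. *)
- apply: (@eventually_constant_diag _ _ (fun v i => chi P v (sigma i))).
    apply: eventually_constant_tuple => j.
    by apply: eval_term_strongly_convergent => // x fvx; apply: hxi; exists j.
  by move=> v; apply: chi_strongly_convergent.
- by apply: eventually_constant_comp; apply: IHB.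
- by apply: eventually_constant_comp2; [apply: IHB|apply: IHC] => x fvx;
    apply: hxi; [left|right].
- by apply: eventually_constant_comp2; [apply: IHB|apply: IHC] => x fvx;
    apply: hxi; [left|right].
- by apply: (@eventually_constant_comp2 _ _ _ implb); [apply: IHB|apply: IHC] =>
    x fvx; apply: hxi; [left|right].
Qed.

Theorem theorem4p14 (t : term) (A : formula) (xi : environment)
  (hxi : forall x : var,
    setU (fv_term t) (fv_formula A) x -> strongly_convergent (xi x)) :
  strongly_convergent (eval_term xi t) /\
  strongly_convergent (eval_formula xi A).
Proof.
split.
- by apply: eval_term_strongly_convergent => x fvx; apply: hxi; left.
- by apply: eval_formula_strongly_convergent => x fvx; apply: hxi; right.
Qed.
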